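(* Let $k$ be a field, let $G$ be a finite simple graph with vertex set $V_G=\{x_1,\ldots,x_n\}$ and edge set $E_G$, and let $I(G)\subseteq R=k[x_1,\ldots,x_n]$ be its edge ideal. Let $\{m_1,\ldots,m_{\#E_G}\}$ be the $\#E_G$ largest monomials of degree $2$ in $R$ with respect to the lexicographical ordering. Then, for all $i\ge 0$, $$\beta_{i,i+2}(I(G)) \leq \sum_{t=1}^{\#E_G} \binom{u_t -1}{i},$$ where $u_t$ is the largest index of a variable dividing $m_t$.
   Context: A simple graph has no loops or multiple edges; it need not be connected. The edge ideal of $G$ is $I(G)=\langle x_ix_j \mid \{x_i,x_j\}\in E_G\rangle\subseteq R=k[x_1,\ldots,x_n]$. For a homogeneous ideal $I\subseteq R$ (standard grading), the graded Betti numbers are $\beta_{i,j}(I)=\dim_k \operatorname{Tor}^R_i(I,k)_j$. The lexicographical ordering on monomials: $x_1^{a_1}\cdots x_n^{a_n}>_{lex}x_1^{b_1}\cdots x_n^{b_n}$ if for some $s$ one has $a_1=b_1,\ldots,a_{s-1}=b_{s-1}$ and $a_s>b_s$. *)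

(* Defs.v *)
From HB Require Import structures.
From mathcomp Require Import all_boot all_order all_algebra.
From mathcomp Require Import mpoly.

Set Implicit Arguments.
Unset Strict Implicit.
Unset Printing Implicit Defensive.

Import GRing.Theory.
Local Open Scope ring_scope.

Definition ideal_generated (R : comNzRingType) (S : R -> Prop) (f : R) : Prop :=
  exists s : seq (R * R),
    (forall p, p \in s -> S p.2) /\ f = \sum_(p <- s) p.1 * p.2.

(* A simple graph on 'I_n is given by its edge set, a set of 2-subsets. *)
Definition simple_graph (n : nat) (E : {set {set 'I_n}}) : Prop :=
  forall e, e \in E -> #|e| = 2.

Definition edge_ideal (k : fieldType) (n : nat) (E : {set {set 'I_n}}) :
    {mpoly k[n]} -> Prop :=
  ideal_generated
    (fun g => exists i j : 'I_n, [set i; j] \in E /\ g = 'X_i * 'X_j).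

(* A graded resolution of the ideal I of R = k[x_1..x_n] by free modules
     ... -> F_2 -> F_1 -> F_0 -> I -> 0,   F_i = \bigoplus_a R(- gfr_deg i a).
   Elements of F_i are row vectors and maps act by right multiplication.
   The map F_i.+1 -> F_i has degree 0: every monomial of its (a, b) entry has
   degree gfr_deg i.+1 a - gfr_deg i b, and the entry is 0 if this is
   negative. The resolution need not be minimal. *)
Record graded_free_resolution (k : fieldType) (n : nat)
    (I : {mpoly k[n]} -> Prop) := GradedFreeResolution {
  gfr_rank : nat -> nat;
  gfr_deg : forall i, 'I_(gfr_rank i) -> nat;
  gfr_diff : forall i, 'M[{mpoly k[n]}]_(gfr_rank i.+1, gfr_rank i);
  gfr_aug : 'cV[{mpoly k[n]}]_(gfr_rank 0);
  gfr_diff_homog : forall i a b m, m \in msupp (gfr_diff i a b) ->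
    (mdeg m + gfr_deg b = gfr_deg a)%N;
  gfr_aug_homog : forall a m, m \in msupp (gfr_aug a ord0) ->
    mdeg m = gfr_deg a;
  gfr_aug_image : forall f,
    I f <-> exists v : 'rV_(gfr_rank 0), f = (v *m gfr_aug) ord0 ord0;
  gfr_exact0 : forall v : 'rV_(gfr_rank 0),
    v *m gfr_aug = 0 <->
    exists w : 'rV_(gfr_rank 1), v = w *m gfr_diff 0;
  gfr_exact : forall i (v : 'rV_(gfr_rank i.+1)),
    v *m gfr_diff i = 0 <->
    exists w : 'rV_(gfr_rank i.+2), v = w *m gfr_diff i.+1
}.

Section Betti.

Variables (k : fieldType) (n : nat) (I : {mpoly k[n]} -> Prop).
Variable F : graded_free_resolution I.

(* With k = R / (x_1, ..., x_n), the module F_i (x) k is k ^ (gfr_rank F i)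
   and the matrix of d (x) k consists of the constant terms of that of d. *)
Definition tor_diff (i : nat) : 'M[k]_(gfr_rank F i.+1, gfr_rank F i) :=
  map_mx (mcoeff 0%MM) (gfr_diff F i).

(* The row space of tor_part i j is (F_i (x) k)_j. *)
Definition tor_part (i j : nat) : 'M[k]_(gfr_rank F i) :=
  diag_mx (\row_a (gfr_deg a == j)%:R).

Definition tor_cycles (i j : nat) : 'M[k]_(gfr_rank F i) :=
  match i with
  | 0 => tor_part 0 j
  | i'.+1 => (tor_part i'.+1 j :&: kermx (tor_diff i'))%MS
  end.

Definition tor_boundaries (i j : nat) : 'M[k]_(gfr_rank F i.+1, gfr_rank F i) :=
  tor_part i.+1 j *m tor_diff i.

(* The graded Betti number dim_k Tor_i^R(I, k)_j, where Tor_i^R(I, k) is the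
   homology of F (x) k at F_i (x) k; by tor_boundaries_sub below, the
   subtraction is never truncated. *)
Definition graded_betti (i j : nat) : nat :=
  (\rank (tor_cycles i j) - \rank (tor_boundaries i j))%N.

Lemma tor_boundaries_part i j : (tor_boundaries i j <= tor_part i j)%MS.
Proof.
suff -> : tor_boundaries i j = tor_boundaries i j *m tor_part i j by apply: submxMl.
apply/matrixP=> a b; rewrite /tor_boundaries /tor_part mul_mx_diag mul_diag_mx.
rewrite !mxE; case: (eqVneq (gfr_deg a) j) => [aj|_]; last by rewrite !mul0r.
case: (eqVneq (gfr_deg b) j) => [_|bj]; first by rewrite mulr1.
rewrite mulr0 mul1r; apply/eqP; rewrite mcoeff_eq0.
apply/negP=> /gfr_diff_homog; rewrite mdeg0 add0n => ba.
by rewrite ba aj eqxx in bj.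
Qed.

Lemma tor_diffK i : tor_diff i.+1 *m tor_diff i = 0.
Proof.
rewrite /tor_diff -map_mxM; suff -> : gfr_diff F i.+1 *m gfr_diff F i = 0.
  by rewrite map_mx0.
apply/row_matrixP=> a; rewrite row0 row_mul; apply/gfr_exact.
by exists (delta_mx 0 a); rewrite rowE.
Qed.

Lemma tor_boundaries_sub i j : (tor_boundaries i j <= tor_cycles i j)%MS.
Proof.
case: i => [|i]; first exact: tor_boundaries_part.
rewrite sub_capmx tor_boundaries_part; apply/sub_kermxP.
by rewrite /tor_boundaries -mulmxA tor_diffK mulmx0.
Qed.

End Betti.

Definition lex_gt (n : nat) (a b : 'X_{1..n}) : Prop :=
  exists s : 'I_n, (forall t : 'I_n, (t < s)%N -> a t = b t) /\ (b s < a s)%N.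

Definition lex_largest (n d q : nat) (m : q.-tuple 'X_{1..n}) : Prop :=
  [/\ uniq m,
      forall t, t \in (m : seq _) -> mdeg t = d
    & forall t b, t \in (m : seq _) -> mdeg b = d -> b \notin (m : seq _) ->
        lex_gt t b].

(* The variables are x_1, ..., x_n, so x_i is 'X_v with v = i - 1. *)
Definition max_index (n : nat) (m : 'X_{1..n}) : nat :=
  \max_(v < n | (0 < m v)%N) v.+1.

(* Main.v *)
From HB Require Import structures.
Require Import Defs.
From mathcomp Require Import all_boot all_order all_algebra all_fingroup.
From mathcomp Require Import mpoly zify.

(** Write V for the span of the variables.  An edge ideal I has no nonzero
    element of degree less than 2, so Tor_i(I, k) in degree i + 2 should embed
    in the space of Koszul cycles inside the i-th exterior power of V tensored
    with the degree 2 part of I.  The proof makes this embedding explicit,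
    bounds the space of cycles by a count of sets of variables, and compares
    that count with the lexicographic one.

    From an arbitrary resolution to Koszul cycles.  In the double complex
    formed by the Koszul complex and the resolution F, a Tor cycle z is pushed
    from F_i down to I by alternating the differential of F with a monomial
    contracting homotopy of the Koszul complex ([koszul_contraction], valid in
    every characteristic).  The result of this [zigzag] is a Koszul cycle with
    coefficients in I ([koszul_zigzag]), and if it vanishes then z was a
    boundary ([zigzag_eq0]).  Hence the Betti number is at most the size of any
    family of coordinates which detects Koszul cycles ([betti_le_detect]).

    From Koszul cycles to colon ideals.  Order the edges.  If x_e is the last
    edge monomial occurring in a cycle, with coefficient at the exterior
    monomial S, then every variable of S must carry x_e into the ideal of the
    earlier edges: otherwise one term of the Koszul boundary cannot cancel.  So
    the coordinates (S, e) with S inside the set W_e of those variables detect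
    cycles ([koszul_detect]), and the Betti number is at most the sum over the
    edges of C(#W_e, i).  This is the bound given by iterated mapping cones,
    without the mapping cones.

    The order of the edges.  List the vertices greedily, each of maximal degree
    in the graph induced by it and the later ones ([greedy_order]), and order
    the edges lexicographically by positions.  Let s_a be the number of later
    neighbours of the vertex v in position a.  Enlarge W_e, for the edges e from
    v to later vertices, so that it contains all vertices before v; these sets
    then have a, a + 1, ..., a + s_a - 1 elements ([sum_linear_colon]).  As s is
    nonincreasing, the cells (a, j) with j < s_a form a Young diagram, and #W_e
    is the index of the antidiagonal of the cell of e.

    Comparison with the lexicographic segment.  Let h_b be the number of cells
    on the antidiagonal b, and g_b the number of monomials x_a x_b, a <= b,
    among the #E largest ones; both sequences have sum #E.  Macaulay's theorem
    in two variables says that h is nonincreasing once it fails to be maximal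
    ([diag_count_anti]), while g never falls more than one below an earlier
    value ([lex_columnS]).  So once h is below g it stays there, and the
    inequality between the sums weighted by the nondecreasing function C(b, i)
    follows ([single_crossing]). *)

Set Implicit Arguments.
Unset Strict Implicit.
Unset Printing Implicit Defensive.

Import GRing.Theory.
Local Open Scope ring_scope.

(** * The Koszul complex and its monomial contraction *)

Section Koszul.
Variables (k : fieldType) (n : nat).
Implicit Types (S T : {set 'I_n}) (s t : 'I_n) (m : 'X_{1..n}) (p : {mpoly k[n]}).

(** An element of the Koszul complex tensored with a free module of rank r: the
    value at S is the coefficient of the exterior monomial e_S.  Chains need not
    be homogeneous in the exterior degree. *)
Definition chain (r : nat) := {set 'I_n} -> 'rV[{mpoly k[n]}]_r.

Lemma mcoeffXUM s p m :
  ('X_s * p)@_m = if m s == 0%N then 0 else p@_(m - U_(s)).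
Proof.
have [ms0|ms] := eqVneq (m s) 0%N; last first.
  have le_sm : (U_(s) <= m)%MM by rewrite lep1mP.
  by rewrite -[in LHS](submK le_sm) mulrC addmC mcoeffMX.
apply: memN_msupp_eq0; rewrite mulrC (perm_mem (msuppMX _ _)).
by apply/mapP=> -[m' _ Em]; move: ms0; rewrite Em mnmDE mnm1E eqxx.
Qed.

Definition ksign s T : k := (-1) ^+ #|[set t in T | (t < s)%N]|.

Definition koszul r (c : chain r) : chain r := fun T =>
  \sum_(s | s \notin T) (ksign s T *: 'X_s) *: c (s |: T).

Lemma mcoeff_koszul r (c : chain r) T b m :
  (koszul c T 0 b)@_m =
  \sum_(s | (s \notin T) && (m s != 0%N)) ksign s T * (c (s |: T) 0 b)@_(m - U_(s)).
Proof.
rewrite /koszul summxE raddf_sum /= big_mkcondr /=; apply: eq_bigr => s _.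
by rewrite mxE -scalerAl mcoeffZ mcoeffXUM; case: eqP => //=; rewrite mulr0.
Qed.

Lemma eq_koszul r (c c' : chain r) : c =1 c' -> koszul c =1 koszul c'.
Proof. by move=> eq_c T; apply: eq_bigr => s _; rewrite eq_c. Qed.

Lemma koszulD r (c c' : chain r) T :
  koszul (fun S => c S + c' S) T = koszul c T + koszul c' T.
Proof. by rewrite /koszul -big_split; apply: eq_bigr => s _; rewrite scalerDr. Qed.

Lemma koszulM r r' (c : chain r) (A : 'M_(r, r')) T :
  koszul (fun S => c S *m A) T = koszul c T *m A.
Proof. by rewrite /koszul mulmx_suml; apply: eq_bigr => s _; rewrite -scalemxAl. Qed.

Lemma ksignU s t T : s \notin T ->
  ksign t (s |: T) = (if (s < t)%N then - ksign t T else ksign t T).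
Proof.
move=> sT; rewrite /ksign; have [st|st] := boolP (s < t)%N.
  have ->: [set r in s |: T | (r < t)%N] = s |: [set r in T | (r < t)%N].
    by apply/setP=> r; rewrite !inE; case: (eqVneq r s) => // ->; rewrite st.
  by rewrite cardsU1 inE (negPf sT) exprS mulN1r.
congr (_ ^+ #|pred_of_set _|); apply/setP=> r; rewrite !inE.
by case: (eqVneq r s) => // ->; rewrite (negPf st) (negPf sT).
Qed.

(** The terms removing s then t and t then s cancel, because the larger of the
    two variables sees one more sign when the smaller is still present. *)
Lemma koszulK r (c : chain r) T : koszul (koszul c) T = 0.
Proof.
pose w (s t : 'I_n) := (ksign s T *: 'X_s * (ksign t (s |: T) *: 'X_t)) *: c (t |: (s |: T)).
have -> : koszul (koszul c) T = \sum_(s | s \notin T) \sum_(t | t \notin s |: T) w s t.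
  apply: eq_bigr => s _; rewrite scaler_sumr; apply: eq_bigr => t _.
  by rewrite scalerA.
have wC s t : s \notin T -> t \notin T -> (s < t)%N -> w s t = - w t s.
  move=> sT tT st; rewrite /w (ksignU _ sT) (ksignU _ tT) st ltnNge ltnW //=.
  rewrite setUCA scaleNr mulrN scaleNr; congr (- (_ *: _)).
  by rewrite -!scalerAl -!scalerAr !scalerA [in RHS]mulrC ['X_t * _]mulrC.
pose Q s t := [&& s \notin T, t \notin T & (s < t)%N].
transitivity (\sum_s \sum_(t | Q s t) (w s t + w t s)).
  under [RHS]eq_bigr do rewrite big_split.
  rewrite big_split /= [X in _ = _ + X](exchange_big_dep predT) //= -big_split /=.
  rewrite big_mkcond /=; apply: eq_bigr => s _.
  case: ifP => sT; last first.
    by rewrite !big1 ?addr0 // => t; rewrite /Q sT ?andbF.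
  rewrite (bigID (fun t : 'I_n => (s < t)%N)) /=; congr (_ + _); apply: eq_bigl => t.
    rewrite /Q sT !inE negb_or; case: (ltngtP s t) => st; rewrite ?andbF ?andbT //;
      by case: eqP st => // ->; rewrite ltnn.
  rewrite /Q sT !inE negb_or -leqNgt leq_eqVlt -val_eqE /=.
  by case: (eqVneq (val t) (val s)) => /= [->|_]; rewrite ?ltnn ?andbF.
by rewrite big1 // => s _; rewrite big1 // => t /and3P[sT tT st]; rewrite (wC s t) ?addNr.
Qed.

(** Division by X_s of the part of p made of the monomials whose smallest
    variable is s. *)
Definition contract s p : {mpoly k[n]} :=
  \sum_(m <- msupp p | (m s != 0%N) && [forall t : 'I_n, (t < s)%N ==> (m t == 0%N)])
     p@_m *: 'X_[m - U_(s)].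

Lemma mcoeff_contract s p m :
  (contract s p)@_m =
  if [forall t : 'I_n, (t < s)%N ==> (m t == 0%N)] then p@_(m + U_(s)) else 0.
Proof.
pose below m := [forall t : 'I_n, (t < s)%N ==> (m t == 0%N)].
have belowU : below (m + U_(s))%MM = below m.
  apply: eq_forallb => t; case: ltnP => //= ts.
  have /negPf st : s != t by apply: contraTneq ts => ->; rewrite ltnn.
  by rewrite mnmDE mnm1E st addn0.
have -> : (contract s p)@_m =
    \sum_(m' <- msupp p) (if below m' then p@_m' * (m' == m + U_(s))%MM%:R else 0).
  rewrite /contract raddf_sum /= big_mkcond /=.
  apply: eq_bigr => m' _; rewrite -/(below m').
  rewrite mcoeffZ mcoeffX; have [ms0|ms] := eqVneq (m' s) 0%N => /=.
    case: ifP => // _; case: eqP => [Em|_]; last by rewrite mulr0.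
    by move: ms0; rewrite Em mnmDE mnm1E eqxx addn1.
  by rewrite -(inj_eq (@addIm _ U_(s)%MM)) submK // lep1mP.
rewrite -[X in if X then _ else _]/(below m) -belowU.
case: ifP => bm; last first.
  rewrite big1 // => m' _; case: ifP => // bm'.
  by case: eqP => [Em|_]; [rewrite -Em bm' in bm | rewrite mulr0].
rewrite [in RHS](mpolyE p) raddf_sum; apply: eq_bigr => m' _ /=.
rewrite mcoeffZ mcoeffX; case: ifP => // bm'.
by case: eqP => [Em|_]; [rewrite -Em bm' in bm | rewrite mulr0].
Qed.

Lemma contract_linear s (a : k) p q :
  contract s (a%:MP * p + q) = a%:MP * contract s p + contract s q.
Proof.
apply/mpolyP=> m; rewrite mcoeffD mcoeffCM !mcoeff_contract.
by case: ifP => _; rewrite ?mcoeffD ?mcoeffCM // mulr0 addr0.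
Qed.

(** On the k-basis e_S x^m, the homotopy moves the smallest variable s of the
    pair (S, m) from x^m into e_S when s is not in S, and is 0 otherwise.  No
    coefficient is divided, so it works over every field. *)
Definition contraction r (c : chain r) : chain r := fun S =>
  if [pick s in S | [forall t in S, (s <= t)%N]] is Some s
  then map_mx (contract s) (c (S :\ s)) else 0.

Lemma contraction_min r (c : chain r) S s :
  s \in S -> (forall t, t \in S -> (s <= t)%N) ->
  contraction c S = map_mx (contract s) (c (S :\ s)).
Proof.
move=> sS min_s; rewrite /contraction; case: pickP => [s' /andP[s'S min_s']|/(_ s)].
  suff -> : s' = s by [].
  apply/val_inj/eqP; rewrite eqn_leq min_s // andbT.
  by have /implyP/(_ sS) := forallP min_s' s.
by rewrite sS /= => /negbT/negP[]; apply/forallP=> t; apply/implyP/min_s.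
Qed.

Lemma contraction0 r (c : chain r) : contraction c set0 = 0.
Proof. by rewrite /contraction; case: pickP => // s; rewrite inE. Qed.

Lemma eq_contraction r (c c' : chain r) : c =1 c' -> contraction c =1 contraction c'.
Proof. by move=> eq_c S; rewrite /contraction; case: pickP => // s; rewrite eq_c. Qed.

Lemma contraction_linear r (a : k) (c c' : chain r) S :
  contraction (fun S => a%:MP *: c S + c' S) S =
  a%:MP *: contraction c S + contraction c' S.
Proof.
rewrite /contraction; case: pickP => [s _|_]; last by rewrite scaler0 addr0.
by apply/rowP=> b; rewrite !mxE contract_linear.
Qed.

(** The contraction h satisfies koszul h + h koszul = id away from the constants
    of exterior degree 0; on cycles only the first summand is left.  At a basis
    element e_T x^m with smallest variable s0, if s0 is not in T then the single
    term that puts s0 back contributes, and if s0 is in T then the required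
    value is read off the cycle condition at T minus s0 and x^m X_s0. *)
Lemma koszul_contraction r (c : chain r) :
  koszul c =1 (fun=> 0) -> (forall b, (c set0 0 b)@_0%MM = 0) ->
  koszul (contraction c) =1 c.
Proof.
move=> cycle_c c00 T; apply/rowP=> b; apply/mpolyP=> m.
rewrite mcoeff_koszul.
(* the smallest variable of e_S x^m' X_t is t *)
have coefE S t m' : t \in S -> (forall t', t' \in S -> (t <= t')%N) ->
    (forall t' : 'I_n, (t' < t)%N -> m' t' = 0%N) ->
    (contraction c S 0 b)@_m' = (c (S :\ t) 0 b)@_(m' + U_(t)).
  move=> tS min_t low_m'; rewrite (contraction_min _ tS min_t) mxE mcoeff_contract.
  case: forallP => // -[] t'; apply/implyP=> lt_t't; exact/eqP/low_m'.
pose supp := [set s : 'I_n | (s \in T) || (m s != 0%N)].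
have [supp0|[s1 s1supp]] := set_0Vmem supp.
  have T0 : T = set0.
    by apply/setP=> s; have := in_set0 s; rewrite -supp0 !inE; case: (s \in T).
  have m0 : m = 0%MM.
    apply/mnmP=> s; have := in_set0 s; rewrite -supp0 !inE T0 inE mnm0E /=.
    by move/negbFE/eqP.
  by rewrite big1 ?T0 ?m0 ?c00 // => s; rewrite mnm0E eqxx andbF.
have [s0 s0supp min_s0] : exists2 s0, s0 \in supp & forall t, t \in supp -> (s0 <= t)%N.
  by case: (arg_minnP (fun s : 'I_n => val s) s1supp) => s0; exists s0.
have memsupp t : (t \in T) || (m t != 0%N) -> (s0 <= t)%N.
  by move=> tsupp; apply: min_s0; rewrite inE.
have low_m (t : 'I_n) : (t < s0)%N -> m t = 0%N.
  move=> ts; apply/eqP; apply: contraTT ts => mt.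
  by rewrite -leqNgt memsupp ?mt ?orbT.
have min_T t : t \in T -> (s0 <= t)%N.
  by move=> tT; apply: memsupp; rewrite tT.
have [s0T|s0T] := boolP (s0 \in T); last first.
  have ms0 : m s0 != 0%N by move: s0supp; rewrite inE (negPf s0T).
  rewrite (bigD1 s0) /=; last by rewrite s0T.
  rewrite (coefE _ s0) ?setU11 //; first last.
  - by move=> t ts; rewrite mnmBE low_m.
  - by move=> t /setU1P[->//|/min_T].
  rewrite submK ?lep1mP // setU1K // /ksign.
  have -> : [set t in T | (t < s0)%N] = set0.
    by apply/setP=> t; rewrite !inE; case tT: (t \in T) => //=; rewrite ltnNge min_T.
  rewrite cards0 mul1r big1 ?addr0 // => s /andP[/andP[sT ms] ss0].
  have lt_s0s : (s0 < s)%N.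
    by rewrite ltn_neqAle val_eqE eq_sym ss0 memsupp ?ms ?orbT.
  have [r0 r0S min_r0] : exists2 r0, r0 \in s |: T & forall t, t \in s |: T -> (r0 <= t)%N.
    case: (arg_minnP (fun s : 'I_n => val s) (setU11 s T)) => r0 r0S minr0.
    by exists r0.
  rewrite (contraction_min _ r0S min_r0) mxE mcoeff_contract.
  case: forallP => [/(_ s0)|]; last by rewrite mulr0.
  have lt_s0r0 : (s0 < r0)%N.
    case/setU1P: r0S => [->//|r0T]; rewrite ltn_neqAle min_T // andbT.
    by apply: contraNneq s0T => /val_inj->.
  by rewrite lt_s0r0 mnmBE mnm1E (negPf ss0) subn0 (negPf ms0).
have := congr1 (fun v : 'rV__ => (v 0 b)@_(m + U_(s0))) (cycle_c (T :\ s0)).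
rewrite /= mcoeff_koszul mxE mcoeff0 (bigD1 s0) /=; last first.
  by rewrite !inE eqxx mnmDE mnm1E eqxx addn1.
rewrite setD1K // addmK; set X := _@__.
have -> : ksign s0 (T :\ s0) = 1.
  rewrite /ksign; suff -> : [set t in T :\ s0 | (t < s0)%N] = set0 by rewrite cards0.
  apply/setP=> t; rewrite !inE; case tT: (t \in T); rewrite ?andbF //.
  by rewrite [(t < s0)%N]ltnNge min_T // andbF.
rewrite mul1r => /eqP; rewrite addr_eq0 => /eqP ->; rewrite -sumrN.
apply: eq_big => [s|s /andP[sT ms]].
  rewrite !inE mnmDE mnm1E; case: (eqVneq s s0) => [->|ss0]; first by rewrite s0T andbF.
  by rewrite andbT addn0.
have ss0 : s != s0 by apply: contraNneq sT => ->.
rewrite (coefE _ s0) ?setU1r //; first last.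
- by move=> t ts; rewrite mnmBE low_m.
- move=> t /setU1P[->|/min_T//]; by apply: memsupp; rewrite ms orbT.
rewrite -mulNr; congr (_ * _).
  rewrite -[in LHS](setD1K s0T) ksignU ?inE ?eqxx // ltn_neqAle val_eqE.
  by rewrite eq_sym ss0 memsupp ?ms ?orbT.
have -> : (s |: T) :\ s0 = s |: (T :\ s0).
  apply/setP=> t; rewrite !inE; case: (eqVneq t s0) => // ->.
  by rewrite eq_sym (negPf ss0).
suff -> : (m - U_(s) + U_(s0) = m + U_(s0) - U_(s))%MM by [].
apply/mnmP=> t; rewrite !(mnmDE, mnmBE, mnm1E).
case: (eqVneq s t) => [<-|]; last by rewrite !subn0.
by rewrite eq_sym (negPf ss0) !addn0.
Qed.

End Koszul.

(** * From a free resolution to Koszul cycles *)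

Section Comparison.
Variables (k : fieldType) (n : nat) (I : {mpoly k[n]} -> Prop).
Variable F : graded_free_resolution I.
Local Notation d := (gfr_diff F).
Local Notation chain_of j := (chain k n (gfr_rank F j)).

Lemma gfr_diffK j : d j.+1 *m d j = 0.
Proof.
apply/row_matrixP=> a; rewrite row0 row_mul; apply/gfr_exact.
by exists (delta_mx 0 a); rewrite rowE.
Qed.

Lemma gfr_diff_aug : d 0 *m gfr_aug F = 0.
Proof.
apply/row_matrixP=> a; rewrite row0 row_mul; apply/gfr_exact0.
by exists (delta_mx 0 a); rewrite rowE.
Qed.

(** The staircase in the double complex: apply the differential of F, lift along
    the Koszul differential by the contraction, and repeat until the
    augmentation lands in I. *)
Fixpoint zigzag j : chain_of j -> chain k n 1 :=
  match j with
  | 0 => fun z S => z S *m gfr_aug F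
  | j'.+1 => fun z => zigzag (contraction (fun S => z S *m d j'))
  end.

Lemma eq_zigzag j (z z' : chain_of j) : z =1 z' -> zigzag z =1 zigzag z'.
Proof.
elim: j z z' => [|j IHj] z z' eq_z /=; first by move=> S; rewrite eq_z.
by apply: IHj; apply: eq_contraction => S; rewrite eq_z.
Qed.

Lemma zigzag_linear j (a : k) (z z' : chain_of j) S :
  zigzag (fun S => a%:MP *: z S + z' S) S = a%:MP *: zigzag z S + zigzag z' S.
Proof.
elim: j z z' S => [|j IHj] z z' S /=; first by rewrite mulmxDl scalemxAl.
rewrite -IHj; apply: eq_zigzag => {}S; rewrite -contraction_linear.
by apply: eq_contraction => T; rewrite mulmxDl scalemxAl.
Qed.

(** The condition under which each lift of [zigzag] is a true preimage for the
    Koszul differential; it propagates along the staircase. *)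
Definition liftable j : chain_of j -> Prop :=
  match j with
  | 0 => fun z => koszul (fun S => z S *m gfr_aug F) =1 (fun=> 0)
  | j'.+1 => fun z => koszul (fun S => z S *m d j') =1 (fun=> 0) /\
                      forall b, ((z set0 *m d j') 0 b)@_0%MM = 0
  end.

Lemma liftable_contraction j (z : chain_of j.+1) :
  liftable z -> liftable (contraction (fun S => z S *m d j)).
Proof.
move=> [dz_cycle dz00]; have dz_lift := koszul_contraction dz_cycle dz00.
case: j z dz_cycle dz00 dz_lift => [|j] z dz_cycle dz00 dz_lift /=.
  by move=> T; rewrite koszulM dz_lift -mulmxA gfr_diff_aug mulmx0.
split=> [T|b]; first by rewrite koszulM dz_lift -mulmxA gfr_diffK mulmx0.
by rewrite contraction0 mul0mx mxE mcoeff0.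
Qed.

Lemma koszul_zigzag j (z : chain_of j) : liftable z -> koszul (zigzag z) =1 (fun=> 0).
Proof. by elim: j z => [|j IHj] z // /liftable_contraction/IHj. Qed.

(** Running back up the staircase: exactness of F at each step corrects the
    chain by a Koszul boundary.  The Koszul boundary left at the end has no
    constant term, so it disappears in the tensor product with k. *)
Lemma zigzag_eq0 j (z : chain_of j) : liftable z -> zigzag z =1 (fun=> 0) ->
  exists (y : chain_of j.+1) (w : chain_of j), forall S, z S = y S *m d j + koszul w S.
Proof.
elim: j z => [|j IHj] z Lz z0.
  have [y zy] := fin_all_exists (fun S => (gfr_exact0 (z S)).1 (z0 S)).
  by exists y, (fun=> 0) => S; rewrite -zy /koszul big1 ?addr0 // => s _; rewrite scaler0.
have [y [w zyw]] := IHj _ (liftable_contraction Lz) z0.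
case: Lz => dz_cycle dz00; have dz_lift := koszul_contraction dz_cycle dz00.
have dzy T : (z T - koszul y T) *m d j = 0.
  rewrite mulmxBl -dz_lift (eq_koszul zyw) koszulD koszulK addr0 koszulM.
  by rewrite subrr.
have [y' zy'] := fin_all_exists (fun S => (gfr_exact _).1 (dzy S)).
by exists y', y => S; rewrite -zy' subrK.
Qed.

Lemma zigzag_image j (z : chain_of j) S : I (zigzag z S 0 0).
Proof.
by elim: j z => [|j IHj] z /=; [apply/gfr_aug_image; exists (z S) | apply: IHj].
Qed.

Lemma msupp_contraction r (c : chain k n r) S b m :
  m \in msupp (contraction c S 0 b) ->
  exists2 s, s \in S & (m + U_(s))%MM \in msupp (c (S :\ s) 0 b).
Proof.
rewrite /contraction; case: pickP => [s /andP[sS _]|_]; last by rewrite mxE msupp0.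
rewrite mcoeff_msupp mxE mcoeff_contract; case: ifP => _; last by rewrite eqxx.
by exists s => //; rewrite mcoeff_msupp.
Qed.

Lemma msupp_mulmx r r' (v : 'rV[{mpoly k[n]}]_r) (A : 'M_(r, r')) b m :
  m \in msupp ((v *m A) 0 b) ->
  exists a m1 m2, [/\ m1 \in msupp (v 0 a), m2 \in msupp (A a b) & m = (m1 + m2)%MM].
Proof.
rewrite mxE => /msupp_sum_le/flatten_mapP[a _ /msuppM_le/allpairsP[[m1 m2] /= [H1 H2 ->]]].
by exists a, m1, m2.
Qed.

(** Each step trades one polynomial degree for one exterior degree, so the sum
    of the polynomial degree, the degree of the generator and the exterior
    degree is constant along the staircase. *)
Lemma msupp_zigzag j (z : chain_of j) p D :
    (forall S b m, m \in msupp (z S 0 b) ->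
       #|S| = p /\ (mdeg m + gfr_deg b + p = D)%N) ->
  forall S m, m \in msupp (zigzag z S 0 0) ->
    #|S| = (p + j)%N /\ (mdeg m + (p + j) = D)%N.
Proof.
elim: j z p => [|j IHj] z p homz S m /=.
  move=> /msupp_mulmx[a [m1 [m2 [/homz[cS Dm1] /gfr_aug_homog Dm2 ->]]]].
  by rewrite mdegD Dm2 addn0.
rewrite addnS -addSn; apply: IHj => {}S b {}m /msupp_contraction[s sS].
move=> /msupp_mulmx[a [m1 [m2 [/homz[cS Dm1] /gfr_diff_homog Dm2 Em]]]].
rewrite (cardsD1 s) sS cS; split=> //.
by have := congr1 mdeg Em; rewrite !mdegD mdeg1; lia.
Qed.

Definition const_chain j (v : 'rV[k]_(gfr_rank F j)) : chain_of j :=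
  fun S => if S == set0 then map_mx (@mpolyC n k) v else 0.

Lemma liftable_const j D (v : 'rV_(gfr_rank F j)) :
  (v <= tor_cycles F j D)%MS -> liftable (const_chain v).
Proof.
have koszul0 r (A : 'M_(_, r)) : koszul (fun S => const_chain v S *m A) =1 (fun=> 0).
  move=> T; rewrite koszulM /koszul big1 ?mul0mx // => s _.
  rewrite /const_chain; case: eqP => [/setP/(_ s)|_]; last by rewrite scaler0.
  by rewrite !inE eqxx.
case: j v koszul0 => [|j] v koszul0 /=; first by move=> _; apply: koszul0.
rewrite sub_capmx => /andP[_ /sub_kermxP vd]; split=> [|b]; first exact: koszul0.
rewrite /const_chain eqxx; transitivity ((v *m tor_diff F j) 0 b); last by rewrite vd mxE.
rewrite !mxE raddf_sum /=; apply: eq_bigr => a _.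
by rewrite !mxE mcoeffCM.
Qed.

Lemma tor_partP i D (v : 'rV[k]_(gfr_rank F i)) :
  (v <= tor_part F i D)%MS -> forall a, v 0 a != 0 -> gfr_deg a = D.
Proof.
move=> /submxP[u ->] a; rewrite mul_mx_diag !mxE.
by case: (eqVneq (gfr_deg a) D) => // _; rewrite mulr0 eqxx.
Qed.

Lemma tor_cycles_part i D : (tor_cycles F i D <= tor_part F i D)%MS.
Proof. by case: i => [|i] //=; apply: capmxSl. Qed.

Lemma sub_tor_boundaries i D (v : 'rV[k]_(gfr_rank F i)) y :
  (v <= tor_part F i D)%MS -> v = y *m tor_diff F i -> (v <= tor_boundaries F i D)%MS.
Proof.
move=> /tor_partP degv vy; apply/submxP; exists y.
have tor0 a b : gfr_deg a != gfr_deg b -> tor_diff F i a b = 0.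
  move=> ne_ab; rewrite mxE memN_msupp_eq0 //; apply: contraNN ne_ab.
  by move=> /gfr_diff_homog; rewrite mdeg0 add0n => ->.
have yE a : (y *m tor_part F i.+1 D) 0 a = y 0 a * (gfr_deg a == D)%:R.
  by rewrite mul_mx_diag !mxE.
rewrite /tor_boundaries mulmxA; apply/rowP=> b; rewrite [RHS]mxE.
have [degb|degb] := eqVneq (gfr_deg b) D.
  rewrite vy mxE; apply: eq_bigr => a _; rewrite yE.
  case: (eqVneq (gfr_deg a) D) => [_|aD]; first by rewrite mulr1.
  by rewrite tor0 ?degb // !mulr0.
have -> : v 0 b = 0 by apply/eqP; apply: contraNT degb => /degv ->.
rewrite big1 // => a _; rewrite yE.
case: (eqVneq (gfr_deg a) D) => [aD|_]; last by rewrite mulr0 mul0r.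
by rewrite tor0 ?mulr0 // aD eq_sym.
Qed.

(** The zigzag induces an injective map from Tor_j(I, k) to Koszul cycles. *)
Lemma zigzag_const_boundary j D (v : 'rV_(gfr_rank F j)) :
  (v <= tor_cycles F j D)%MS -> zigzag (const_chain v) =1 (fun=> 0) ->
  (v <= tor_boundaries F j D)%MS.
Proof.
move=> vcyc /(zigzag_eq0 (liftable_const vcyc))[y [w /(_ set0)]].
rewrite /const_chain eqxx => Ev.
apply: (@sub_tor_boundaries _ _ _ (map_mx (mcoeff 0%MM) (y set0))).
  exact: submx_trans vcyc (tor_cycles_part j D).
rewrite -map_mxM; apply/rowP=> b.
have := congr1 (fun u : 'rV__ => (u 0 b)@_0%MM) Ev; rewrite /= !mxE mpolyCK => ->.
rewrite mcoeffD mcoeff_koszul [X in _ + X]big1 ?addr0 ?mxE // => s.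
by rewrite mnm0E eqxx andbF.
Qed.

Section Detection.
Variables (i : nat) (Q : seq ({set 'I_n} * 'X_{1..n})).
Let x0 : {set 'I_n} * 'X_{1..n} := (set0, 0%MM).

Definition zigzag_coords (v : 'rV[k]_(gfr_rank F i)) : 'rV[k]_(size Q) :=
  \row_(x < size Q) (zigzag (const_chain v) (nth x0 Q x).1 0 0)@_(nth x0 Q x).2.

Fact zigzag_coords_linear : linear zigzag_coords.
Proof.
move=> a u v; apply/rowP=> x; rewrite !mxE.
rewrite -mcoeffCM -mcoeffD; set S := (nth _ _ _).1.
have := zigzag_linear a (const_chain u) (const_chain v) S.
move=> /(congr1 (fun w : 'rV__ => w 0 0)); rewrite /= !mxE => <-.
congr (mcoeff _ _); congr (fun_of_matrix _ _ _); apply: eq_zigzag => T.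
rewrite /const_chain; case: eqP => _; last by rewrite scaler0 addr0.
by apply/rowP=> b; rewrite !mxE rmorphD rmorphM.
Qed.
HB.instance Definition _ :=
  GRing.isLinear.Build k 'rV_(gfr_rank F i) 'rV_(size Q) _ zigzag_coords zigzag_coords_linear.

(** The composition of the zigzag with the coordinates in Q is a linear map on
    Tor cycles whose kernel consists of boundaries, so its rank bounds the Betti
    number. *)
Lemma betti_le_detect D :
    (forall c : chain k n 1, koszul c =1 (fun=> 0) -> (forall S, I (c S 0 0)) ->
       (forall S m, m \in msupp (c S 0 0) -> #|S| = i /\ (mdeg m + i = D)%N) ->
       (forall x, x \in Q -> (c x.1 0 0)@_x.2 = 0) -> c =1 (fun=> 0)) ->
  (graded_betti F i D <= size Q)%N.
Proof.
move=> detect; pose M := lin1_mx zigzag_coords.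
rewrite leq_subLR -(mxrank_mul_ker (tor_cycles F i D) M) addnC.
apply: leq_add; last exact: rank_leq_col.
apply/mxrankS/rV_subP => v; rewrite sub_capmx => /andP[vcyc /sub_kermxP].
rewrite mul_rV_lin1 => v0; apply: (zigzag_const_boundary vcyc).
apply: detect.
- exact: koszul_zigzag (liftable_const vcyc).
- by move=> S; apply: zigzag_image.
- move=> S m; apply: (@msupp_zigzag i _ 0) => {}S b {}m.
  rewrite /const_chain; case: eqP => [->|_]; last by rewrite mxE msupp0.
  rewrite mxE msuppC; case: eqP => // /eqP vb; rewrite inE => /eqP->.
  rewrite mdeg0 addn0 cards0; split=> //.
  exact: tor_partP (submx_trans vcyc (tor_cycles_part i D)) _ vb.
move=> x xQ; have lt_xQ : (index x Q < size Q)%N by rewrite index_mem.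
have := congr1 (fun u : 'rV__ => u 0 (Ordinal lt_xQ)) v0.
by rewrite !mxE /= nth_index.
Qed.
End Detection.

End Comparison.

(** * Koszul cycles supported on the edges of a graph *)

Section Edges.

(** Descending induction on the rank of x.  If s in S is not in W x, consider
    the Koszul boundary at e_(S minus s) and the monomial (mon x) X_s: a term
    other than the one of (S, x) involves a y of larger rank, where c vanishes
    by induction, or of smaller rank, which would put s in W x. *)
Lemma koszul_detect (k : fieldType) (n : nat) (X : finType) (D : {set X})
    (mon : X -> 'X_{1..n}) (rk : X -> nat) (W : X -> {set 'I_n}) (c : chain k n 1) :
    {in D &, injective rk} ->
    (forall x y s t, x \in D -> y \in D -> (rk y < rk x)%N ->
       (mon x + U_(s) = mon y + U_(t))%MM -> s \in W x) ->
    koszul c =1 (fun=> 0) ->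
    (forall S m, m \in msupp (c S 0 0) -> exists2 x, x \in D & m = mon x) ->
    (forall (S : {set 'I_n}) x, x \in D -> S \subset W x -> (c S 0 0)@_(mon x) = 0) ->
  c =1 (fun=> 0).
Proof.
move=> rk_inj WP cycle_c supp_c c0.
suff cD S x : x \in D -> (c S 0 0)@_(mon x) = 0.
  move=> S; apply/rowP=> j; rewrite ord1 mxE; apply/mpolyP=> m; rewrite mcoeff0.
  have [/supp_c[x xD ->]|/memN_msupp_eq0//] := boolP (m \in msupp (c S 0 0)).
  exact: cD.
pose N := (\max_x rk x)%N.
have [d] := ubnP (N - rk x); elim: d S x => // d IHd S x Nd xD.
have [SW|/subsetPn[s sS sW]] := boolP (S \subset W x); first exact: c0.

have := congr1 (fun v : 'rV__ => (v 0 0)@_(mon x + U_(s))) (cycle_c (S :\ s)).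
rewrite /= mcoeff_koszul mxE mcoeff0 (bigD1 s) /=; last first.
  by rewrite !inE eqxx mnmDE mnm1E eqxx addn1.
rewrite setD1K // addmK big1 => [|t /andP[/andP[_ mt] ts]].
  by rewrite addr0 => /eqP; rewrite mulf_eq0 signr_eq0 => /eqP.
have [/supp_c[y yD Ey]|/memN_msupp_eq0->] :=
  boolP ((mon x + U_(s) - U_(t))%MM \in msupp (c (t |: S :\ s) 0 0)); last by rewrite mulr0.
have Exy : (mon x + U_(s) = mon y + U_(t))%MM by rewrite -Ey submK // lep1mP.
rewrite Ey; have [lt_xy|lt_yx|/(rk_inj _ _ xD yD) eq_xy] := ltngtP (rk x) (rk y).
- rewrite IHd ?mulr0 //; have : (rk y <= N)%N := leq_bigmax y.
  by move: Nd lt_xy; lia.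
- by rewrite (WP _ _ _ _ xD yD lt_yx Exy) in sW.
by case/eqP: ts; apply/esym/eqP; rewrite -eq_mnm1 -(eqm_add2l (mon x)) Exy eq_xy.
Qed.

Lemma msupp_edge_ideal (k : fieldType) n (E : {set {set 'I_n}}) f m :
    edge_ideal (k := k) E f -> m \in msupp f -> mdeg m = 2%N ->
  exists u v, [set u; v] \in E /\ m = (U_(u) + U_(v))%MM.
Proof.
move=> [s [sP ->]] /msupp_sum_le/flatten_mapP[p].
rewrite filter_predT => /sP[u [v [uvE ->]]].
rewrite -mpolyXD => /msuppM_le/allpairsP[[m1 m2] /= [_ /mem_msuppXP <- ->]] /eqP.
rewrite !mdegD !mdeg1 -[X in _ == X]add0n eqn_add2r mdeg_eq0 => /eqP->.
by exists u, v; rewrite add0m.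
Qed.

Variables (n : nat) (E : {set {set 'I_n}}) (pos : {perm 'I_n}).

(** The permutation pos gives the position of each vertex in the chosen order. *)
Definition later_nbrs u := [set v | (pos u < pos v)%N && ([set u; v] \in E)].

Definition arcs := [set uv : 'I_n * 'I_n | uv.2 \in later_nbrs uv.1].

(** Contains every variable s such that X_s X_u X_v is divisible by an earlier
    edge monomial: such an edge joins s to u or v, hence starts at an earlier
    vertex s, or starts at u and ends at some s before v. *)
Definition linear_colon (uv : 'I_n * 'I_n) :=
  [set s | (pos s < pos uv.1)%N] :|: [set s in later_nbrs uv.1 | (pos s < pos uv.2)%N].

(** Encodes the lexicographic order of arcs, as positions are less than n. *)
Definition arc_rank (uv : 'I_n * 'I_n) := (pos uv.1 * n + pos uv.2)%N.

Definition arc_mnm (uv : 'I_n * 'I_n) : 'X_{1..n} := (U_(uv.1) + U_(uv.2))%MM.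

Lemma arc_rank_lt x y : (arc_rank y < arc_rank x)%N ->
  (pos y.1 < pos x.1)%N \/ y.1 = x.1 /\ (pos y.2 < pos x.2)%N.
Proof.
rewrite /arc_rank; case: (ltngtP (pos y.1) (pos x.1)) => [||/val_inj/perm_inj ->].
- by left.
- have := ltn_ord (pos x.2); nia.
by rewrite ltn_add2l; right.
Qed.

Lemma arc_rank_inj : injective arc_rank.
Proof.
move=> [u v] [u' v']; rewrite /arc_rank /= => Euv.
have [lt_v lt_v'] := (ltn_ord (pos v), ltn_ord (pos v')).
case: (ltngtP (pos u) (pos u')) => [||/val_inj/perm_inj eq_u]; try nia.
by move: Euv; rewrite eq_u => /addnI/val_inj/perm_inj ->.
Qed.

Lemma linear_colonP x y s t : x \in arcs -> y \in arcs ->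
  (arc_rank y < arc_rank x)%N -> (arc_mnm x + U_(s) = arc_mnm y + U_(t))%MM ->
  s \in linear_colon x.
Proof.
rewrite !inE => /andP[x12 _] /andP[y12 yE] lt_yx Exy.
(* an endpoint of the arc y that is not an endpoint of x has to be s *)
have eqs w : (w == y.1) || (w == y.2) -> w != x.1 -> w != x.2 -> s = w.
  move=> wy wx1 wx2; apply/eqP; move: (congr1 (fun m : 'X_{1..n} => m w) Exy).
  rewrite /= !mnmDE !mnm1E ![_ == w]eq_sym (negPf wx1) (negPf wx2) eq_sym.
  by case: (s == w) => //; move: wy; do 2!case: (w == _).
have [lt_u|[Eu lt_v]] := arc_rank_lt lt_yx.
  rewrite (eqs y.1) ?eqxx ?lt_u //; first by apply: contraTneq lt_u => ->; rewrite ltnn.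
  by apply: contraTneq lt_u => ->; rewrite -leqNgt ltnW.
rewrite (eqs y.2) ?eqxx ?orbT //.
- by rewrite -Eu y12 lt_v yE orbT.
- by rewrite -Eu; apply: contraTneq y12 => ->; rewrite ltnn.
by apply: contraTneq lt_v => ->; rewrite ltnn.
Qed.

Lemma betti_le_arcs (k : fieldType) (simpleE : simple_graph E)
    (F : graded_free_resolution (@edge_ideal k n E)) i :
  (graded_betti F i (i + 2) <= \sum_(x in arcs) 'C(#|linear_colon x|, i))%N.
Proof.
pose Q := [seq (A, arc_mnm x) | x <- enum arcs,
                 A <- enum [set A : {set 'I_n} | A \subset linear_colon x & #|A| == i]].
have -> : (\sum_(x in arcs) 'C(#|linear_colon x|, i))%N = size Q.
  rewrite size_allpairs_dep sumnE big_map big_enum /=; apply: eq_bigr => x _.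
  by rewrite -cardE cards_draws.
apply: betti_le_detect => c cycle_c Ic hom_c c0.
apply: (koszul_detect (in2W arc_rank_inj) linear_colonP cycle_c) => [S m mS|S x xD SW].
  have [_ dm] := hom_c S m mS.
  have [|u [v [uvE ->]]] := msupp_edge_ideal (Ic S) mS; first by move: dm; lia.
  have neq_uv : u != v by have := simpleE _ uvE; rewrite cards2; case: eqVneq.
  case: (ltngtP (pos u) (pos v)) => [lt_uv|lt_vu|/val_inj/perm_inj/eqP].
  - by exists (u, v); rewrite ?inE ?lt_uv.
  - by exists (v, u); rewrite ?inE ?lt_vu 1?setUC ?[(U_(u) + _)%MM]addmC.
  by rewrite (negPf neq_uv).
apply/eqP; rewrite mcoeff_eq0; apply/negP => mS; have [cS _] := hom_c _ _ mS.
move: mS; rewrite mcoeff_msupp; case/negP; apply/eqP.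
apply: (c0 (S, arc_mnm x)); apply/allpairsPdep.
exists x, S; split; rewrite ?mem_enum //.
by rewrite inE SW cS eqxx.
Qed.

End Edges.

(** * Greedy orders and Young diagrams *)

Section Order.

Lemma ex_max_in (T : finType) (key : T -> nat) (A : {set T}) :
  A != set0 -> exists2 x, x \in A & forall w, w \in A -> (key w <= key x)%N.
Proof. by case/set0Pn=> x0 x0A; case: (arg_maxnP key x0A) => x; exists x. Qed.

(** Put first a vertex of maximal degree in A.  Its removal can only lower the
    degrees of the other vertices, so the number of later neighbours does not
    increase along the order. *)
Lemma greedy_order (T : finType) (e : rel T) (A : {set T}) :
  exists pos : T -> nat,
    [/\ {in A &, injective pos}, {in A, forall u, (pos u < #|A|)%N} &
        {in A &, forall u v, (pos u <= pos v)%N ->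
          (#|[set w in A | (pos v < pos w)%N && e v w]| <=
             #|[set w in A | (pos u < pos w)%N && e u w]|)%N}].
Proof.
move En: #|A| => N; elim: N A En => [|N IHN] A cA.
  by exists (fun=> 0%N); split=> u; rewrite (cards0_eq cA) !inE.
have A0 : A != set0 by rewrite -card_gt0 cA.
have [x xA max_x] := ex_max_in (fun x => #|[set w in A :\ x | e x w]|) A0.
have [|pos [pos_inj pos_lt pos_deg]] := IHN (A :\ x).
  by move: cA; rewrite (cardsD1 x) xA => -[].
exists (fun u => if u == x then 0%N else (pos u).+1).
have A'P u : u \in A -> u != x -> u \in A :\ x by move=> uA ux; rewrite !inE ux.
split=> [u v uA vA|u uA|u v uA vA].
- case: eqVneq => [->|ux]; case: eqVneq => [->|vx] // -[].
  by apply: pos_inj; apply: A'P.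
- by case: eqVneq => // ux; rewrite ltnS pos_lt ?A'P.
have [->|vx] := eqVneq v x.
  by case: (eqVneq u x) => [->|].
have -> : [set w in A | ((pos v).+1 < (if w == x then 0 else (pos w).+1))%N && e v w] =
          [set w in A :\ x | (pos v < pos w)%N && e v w].
  by apply/setP=> w; rewrite !inE; case: eqVneq => //=; rewrite andbF.
have [->|ux] := eqVneq u x => [_|]; last first.
  rewrite ltnS => le_uv.
  have -> : [set w in A | ((pos u).+1 < (if w == x then 0 else (pos w).+1))%N && e u w] =
            [set w in A :\ x | (pos u < pos w)%N && e u w].
    by apply/setP=> w; rewrite !inE; case: eqVneq => //=; rewrite andbF.
  by apply: pos_deg; rewrite ?A'P.
have -> : [set w in A | (0 < (if w == x then 0 else (pos w).+1))%N && e x w] =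
          [set w in A :\ x | e x w].
  by apply/setP=> w; rewrite !inE; case: eqVneq => //=; rewrite andbF.
apply: leq_trans (max_x v vA); apply: subset_leq_card; apply/subsetP=> w.
rewrite !inE => /andP[/andP[_ ->] /andP[lt_vw ->]]; rewrite !andbT.
by apply: contraTneq lt_vw => ->; rewrite ltnn.
Qed.

Lemma sum_card_below (T : finType) (key : T -> nat) (A : {set T}) (f : nat -> nat) :
    {in A &, injective key} ->
  (\sum_(v in A) f #|[set w in A | (key w < key v)%N]| = \sum_(j < #|A|) f j)%N.
Proof.
move En: #|A| => N; elim: N A En => [|N IHN] A cA key_inj.
  by rewrite (cards0_eq cA) big_set0 big_ord0.
have A0 : A != set0 by rewrite -card_gt0 cA.
have [x xA max_x] := ex_max_in key A0.
have lt_x w : w \in A :\ x -> (key w < key x)%N.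
  rewrite !inE => /andP[wx wA]; rewrite ltn_neqAle max_x // andbT.
  by apply: contraNneq wx => /key_inj->.
have cA' : #|A :\ x| = N by move: cA; rewrite (cardsD1 x) xA => -[].
rewrite (bigD1 x) //= big_ord_recr /= addnC -(IHN _ cA'); last first.
  by move=> u v; rewrite !inE => /andP[_ uA] /andP[_ vA]; apply: key_inj.
congr (_ + f _)%N.
  apply: eq_big => v; first by rewrite !inE andbC.
  case/andP=> vA vx; congr (f _); apply: eq_card => w; rewrite !inE.
  case: eqVneq => //= ->; apply/negbTE; rewrite negb_and -leqNgt ltnW ?orbT //.
  by apply: lt_x; rewrite !inE vx.
rewrite -cA'; apply: eq_card => w; rewrite !inE; case: eqVneq => [->|wx] /=.
  by rewrite ltnn andbF.
by case wA: (w \in A) => //=; rewrite lt_x // !inE wx.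
Qed.

Lemma card_ord_lt n j : (j <= n)%N -> #|[set a : 'I_n | (a < j)%N]| = j.
Proof.
move=> le_jn; by rewrite -sum1dep_card (big_ord_narrow le_jn) sum1_card card_ord.
Qed.

(** The number of cells (a, j), j < s a, with a + j = b, that is, on an
    antidiagonal of the diagram with rows s. *)
Definition diag_count (s : nat -> nat) b := (\sum_(0 <= a < b.+1) (b < a + s a))%N.

(** Macaulay's bound in two variables.  Some row a0 misses the antidiagonal b.
    It then misses the antidiagonal b + 1 too.  Cells of the antidiagonal b + 1
    in rows before a0 move one step left, those in rows after a0 move to the
    preceding row; both moves stay in the diagram, and their images are disjoint,
    lying in rows before a0 and in rows from a0 on. *)
Lemma diag_countS s b : (forall a a', (a <= a')%N -> (s a' <= s a)%N) ->
  (diag_count s b <= b)%N -> (diag_count s b.+1 <= diag_count s b)%N.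
Proof.
move=> s_anti hb; rewrite /diag_count.
have [a0 le_a0 s_a0] : exists2 a0, (a0 <= b)%N & (a0 + s a0 <= b)%N.
  have [/existsP[a sa]|] := boolP [exists a : 'I_b.+1, (a + s a <= b)%N].
    by exists a => //; rewrite -ltnS.
  rewrite negb_exists => /forallP full; move: hb; rewrite /diag_count big_mkord.
  rewrite (eq_bigr (fun=> 1%N)) => [|a _]; last by move: (full a); rewrite -ltnNge => ->.
  by rewrite sum_nat_const card_ord muln1 ltnn.
rewrite (@big_cat_nat _ _ _ a0) //=; last by lia.
rewrite [leqRHS](@big_cat_nat _ _ _ a0) //=; last by lia.
apply: leq_add.
  by apply: leq_sum => a _; case: (ltnP b.+1) => // /ltnW ->.
rewrite big_ltn; last by lia.
rewrite big_add1 /= [(b.+1 < _)%N]ltnNge (leqW s_a0) add0n.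
apply: leq_sum => a _; rewrite addSn ltnS.
by have := s_anti a a.+1 (leqnSn a); case: ltnP; case: ltnP => //; lia.
Qed.

Lemma diag_count_anti s b c : (forall a a', (a <= a')%N -> (s a' <= s a)%N) ->
  (diag_count s b <= b)%N -> (b <= c)%N -> (diag_count s c <= diag_count s b)%N.
Proof.
move=> s_anti hb; elim: c => [|c IHc]; first by rewrite leqn0 => /eqP->.
rewrite leq_eqVlt => /orP[/eqP->//|]; rewrite ltnS => le_bc.
have le_hc := IHc le_bc; apply: leq_trans (le_hc); apply: diag_countS => //.
exact: leq_trans le_hc (leq_trans hb le_bc).
Qed.

(** Let c be the first index with h c < g c.  The difference g b - h b then has
    the sign of f b - f c, or one of them is 0, so the sum of
    (g b - h b) * (f b - f c) is nonnegative; the constant f c drops out because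
    g and h have the same sum. *)
Lemma single_crossing n (g h f : 'I_n -> nat) :
    (forall b c : 'I_n, (b <= c)%N -> (f b <= f c)%N) ->
    (\sum_b g b = \sum_b h b)%N ->
    (forall b c : 'I_n, (h b < g b)%N -> (b <= c)%N -> (h c <= g c)%N) ->
  (\sum_b h b * f b <= \sum_b g b * f b)%N.
Proof.
move=> f_mono eq_gh cross.
have [K HK] : exists K, forall b, (h b * f b + g b * K <= g b * f b + h b * K)%N.
  have [/existsP[c0 Hc0]|] := boolP [exists c, (h c < g c)%N].
    have [c Hc min_c] := @arg_minnP _ c0 (fun c => (h c < g c)%N) val Hc0.
    exists (f c) => b; have [le_cb|lt_bc] := leqP c b.
      have := f_mono _ _ le_cb; have := cross _ _ Hc le_cb; nia.
    have := f_mono _ _ (ltnW lt_bc).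
    have : (g b <= h b)%N by rewrite leqNgt; apply: contraTN lt_bc => /min_c; rewrite -leqNgt.
    nia.
  rewrite negb_exists => /forallP ge_hg.
  (* any constant above all values of f plays the role of f c *)
  exists (\sum_b f b)%N => b; have := ge_hg b; rewrite -leqNgt.
  have : (f b <= \sum_b f b)%N by rewrite (bigD1 b) //= leq_addr.
  nia.
have := leq_sum (index_enum 'I_n) (fun b (_ : xpredT b) => HK b).
by rewrite !big_split /= -!big_distrl /= eq_gh leq_add2r.
Qed.

End Order.

(** * The edge count along antidiagonals *)

Section Profile.
Variables (n : nat) (E : {set {set 'I_n}}) (pos : {perm 'I_n}).
Local Notation later := (later_nbrs E pos).

Lemma card_pos_lt j : (j <= n)%N -> #|[set s | (pos s < j)%N]| = j.
Proof.
move=> le_jn; rewrite -[RHS](card_ord_lt le_jn).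
rewrite -(card_preimset [set a : 'I_n | (a < j)%N] (@perm_inj _ pos)).
by apply: eq_card => s; rewrite !inE.
Qed.

Lemma card_linear_colon uv :
  #|linear_colon E pos uv| =
  (pos uv.1 + #|[set s in later uv.1 | (pos s < pos uv.2)%N]|)%N.
Proof.
rewrite cardsU card_pos_lt; last exact: ltnW.
rewrite [X in (_ - X)%N](_ : _ = 0%N) ?subn0 //; apply/eqP; rewrite cards_eq0 -subset0.
by apply/subsetP=> s; rewrite !inE => /andP[] /ltnW; rewrite leqNgt => /negPf ->.
Qed.

Lemma later_nbrs_bound u : (pos u + #|later u| <= n)%N.
Proof.
rewrite -[leqRHS]card_ord -(cardsC [set s | (pos s < pos u)%N]).
rewrite card_pos_lt ?leq_add2l; last exact: ltnW.
by apply/subset_leq_card/subsetP=> s; rewrite !inE -leqNgt => /andP[/ltnW].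
Qed.

(** The rows of the Young diagram: the number of later neighbours of the vertex
    in position a, extended by 0 to all natural numbers. *)
Definition profile a :=
  oapp (fun a : 'I_n => #|later ((pos^-1)%g a)|) 0%N (insub a).

Lemma profileE (u : 'I_n) : profile (pos u) = #|later u|.
Proof. by rewrite /profile valK /= permK. Qed.

Lemma sum_diag_count (s : nat -> nat) (f : nat -> nat) :
    (forall a : 'I_n, a + s a <= n)%N ->
  (\sum_(a < n) \sum_(j < s a) f (a + j) = \sum_(b < n) diag_count s b * f b)%N.
Proof.
move=> le_sn; transitivity (\sum_(a < n) \sum_(b < n) ((a <= b < a + s a) * f b))%N.
  apply: eq_bigr => a _.
  rewrite -(big_mkord xpredT (fun j => f (a + j)%N)).
  rewrite -(big_mkord xpredT (fun b => (a <= b < a + s a) * f b)%N).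
  transitivity (\sum_(0 + a <= b < a + s a) f b)%N.
    by rewrite big_addn addKn; apply: eq_bigr => j _; rewrite addnC.
  rewrite add0n.
  rewrite (big_nat_widenl _ 0) // (big_nat_widen _ _ n) // big_mkcond.
  by apply: eq_bigr => b _ /=; case: (_ && _); rewrite ?mul1n ?mul0n.
rewrite exchange_big; apply: eq_bigr => b _ /=; rewrite -big_distrl; congr (_ * _)%N.
rewrite /diag_count big_mkord (big_ord_widen _ (fun a => (b < a + s a)%N : nat) (ltn_ord b)).
rewrite [RHS]big_mkcond; apply: eq_bigr => a _ /=.
by rewrite ltnS; case: (a <= b)%N.
Qed.

(** For an arc from u to the later neighbour v, the set [linear_colon] has
    pos u + j elements, where j is the rank of v among the later neighbours of
    u; so arcs correspond to the cells of the diagram with rows [profile]. *)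
Lemma sum_linear_colon (f : nat -> nat) :
  (\sum_(x in arcs E pos) f #|linear_colon E pos x| =
   \sum_(b < n) diag_count profile b * f b)%N.
Proof.
rewrite -sum_diag_count; last first.
  move=> a; have := later_nbrs_bound ((pos^-1)%g a).
  by rewrite -profileE permKV.
rewrite (reindex_inj (@perm_inj _ pos)) /=.
rewrite (eq_bigl (fun x => xpredT x.1 && (x.2 \in later x.1))); last by move=> x; rewrite !inE.
rewrite -(pair_big_dep xpredT (fun u v => v \in later u)
  (fun u v => f #|linear_colon E pos (u, v)|)) /=.
apply: eq_bigr => u _; rewrite profileE.
under eq_bigr do rewrite card_linear_colon /=.
rewrite (sum_card_below (fun c => f (pos u + c)%N)) // => v w _ _.
by move/val_inj/perm_inj.
Qed.

End Profile.

Lemma degree_order n (E : {set {set 'I_n}}) :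
  exists pos : {perm 'I_n}, forall u v, (pos u <= pos v)%N ->
    (#|later_nbrs E pos v| <= #|later_nbrs E pos u|)%N.
Proof.
have [pos [pos_inj pos_lt pos_deg]] :=
  greedy_order (fun u v => [set u; v] \in E) [set: 'I_n].
have lt_n u : (pos u < n)%N by rewrite -[X in (_ < X)%N]card_ord -cardsT pos_lt ?inE.
have ord_inj : injective (fun u => Ordinal (lt_n u)).
  by move=> u v [] /pos_inj; apply; rewrite inE.
exists (perm ord_inj) => u v; rewrite !permE /= => le_uv.
have laterE w : later_nbrs E (perm ord_inj) w =
    [set x in [set: 'I_n] | (pos w < pos x)%N && ([set w; x] \in E)].
  by apply/setP=> x; rewrite !inE !permE.
by rewrite !laterE; apply: pos_deg; rewrite ?inE.
Qed.

Lemma profile_anti n (E : {set {set 'I_n}}) (pos : {perm 'I_n}) :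
    (forall u v, (pos u <= pos v)%N ->
      (#|later_nbrs E pos v| <= #|later_nbrs E pos u|)%N) ->
  forall a a', (a <= a')%N -> (profile E pos a' <= profile E pos a)%N.
Proof.
move=> deg_pos a a' le_aa'; rewrite /profile.
case: insubP => [u' lt_a'n Eu'|//]; case: insubP => [u lt_an Eu|]; last first.
  by rewrite (leq_ltn_trans le_aa').
by apply: deg_pos; rewrite !permKV -[val u]/(nat_of_ord u) Eu Eu'.
Qed.

Lemma card_arcs n (E : {set {set 'I_n}}) (pos : {perm 'I_n}) :
  simple_graph E -> #|arcs E pos| = #|E|.
Proof.
move=> simpleE; pose edge (uv : 'I_n * 'I_n) := [set uv.1; uv.2].
rewrite -(@card_in_imset _ _ edge).
  apply: eq_card => e; apply/imsetP/idP => [[x]|eE].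
    by rewrite !inE => /andP[_ xE] ->.
  have /eqP/cards2P[u [v [neq_uv Ee]]] := simpleE _ eE.
  case: (ltngtP (pos u) (pos v)) => [lt_uv|lt_vu|/val_inj/perm_inj/eqP].
  - by exists (u, v); rewrite ?inE ?lt_uv -?Ee.
  - by exists (v, u); rewrite ?inE ?lt_vu 1?setUC -?Ee // /edge setUC.
  by rewrite (negPf neq_uv).
move=> [u v] [u' v']; rewrite !inE /= => /andP[lt_uv _] /andP[lt_uv' _] /setP Euv.
have := Euv u; have := Euv v; rewrite /edge !inE /= !eqxx orbT => /esym.
case/orP=> /eqP ev /esym/orP[]/eqP eu; rewrite ?ev ?eu //;
  by move: lt_uv lt_uv'; rewrite ?ev ?eu; lia.
Qed.

(** * The lexicographic segment *)

Section Lex.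
Variable n : nat.
Implicit Types (a b v : 'I_n).

Lemma mdeg2P (m : 'X_{1..n}) : mdeg m = 2 ->
  exists a b, (a <= b)%N /\ m = (U_(a) + U_(b))%MM.
Proof.
move=> dm; have [a ma] : exists a, m a != 0%N.
  apply/existsP; rewrite -negb_forall; apply/negP => /forallP m0.
  suff m00 : m = 0%MM by move: dm; rewrite m00 mdeg0.
  by apply/mnmP=> a; rewrite mnm0E; apply/eqP/m0.
have le_am : (U_(a) <= m)%MM by rewrite lep1mP.
have /mdeg1P[b /eqP Eb] : mdeg (m - U_(a))%MM == 1%N.
  by rewrite -(eqn_add2r (mdeg U_(a)%MM)) -mdegD submK // dm mdeg1.
rewrite -(submK le_am) Eb; case: (leqP b a) => [le_ba|/ltnW le_ab].
  by exists b, a.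
by exists a, b; rewrite addmC.
Qed.

Lemma max_index_mul a b : (a <= b)%N -> max_index (U_(a) + U_(b))%MM = b.+1.
Proof.
move=> le_ab; apply/eqP; rewrite eqn_leq /max_index.
rewrite (@leq_bigmax_cond _ _ (fun v : 'I_n => v.+1) b) ?andbT; last first.
  by rewrite mnmDE !mnm1E eqxx addn1.
apply/bigmax_leqP => v; rewrite mnmDE !mnm1E.
by case: eqP => [<-|_] //; case: eqP => [<-|].
Qed.

Lemma mnm2_inj a b a' b' : (a <= b)%N -> (a' <= b')%N ->
  (U_(a) + U_(b) = U_(a') + U_(b'))%MM -> (a, b) = (a', b').
Proof.
move=> le_ab le_ab' Em; have := congr1 (@max_index n) Em.
rewrite !max_index_mul // => -[] /val_inj Eb; move: Em; rewrite Eb => /addIm/eqP.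
by rewrite eq_mnm1 => /eqP->.
Qed.

Variables (q : nat) (m : q.-tuple 'X_{1..n}).
Hypothesis lexm : lex_largest 2 m.

(** The first indices of the monomials of m whose largest variable is b. *)
Definition lex_column b := [set a : 'I_n | (a <= b)%N && ((U_(a) + U_(b))%MM \in (m : seq _))].

Lemma sum_lex_column (f : nat -> nat) :
  (\sum_(t < q) f (max_index (tnth m t) - 1) = \sum_b #|lex_column b| * f b)%N.
Proof.
have [uniq_m deg_m _] := lexm.
pose G := [set ba : 'I_n * 'I_n | ba.2 \in lex_column ba.1].
pose mon (ba : 'I_n * 'I_n) := (U_(ba.2) + U_(ba.1))%MM.
have perm_mG : perm_eq m [seq mon x | x <- enum G].
  apply: uniq_perm => // [|x].
    rewrite map_inj_in_uniq ?enum_uniq // => -[b a] [b' a'].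
    rewrite !mem_enum !inE /= => /andP[le_ab _] /andP[le_ab' _] Em.
    by have [-> ->] := mnm2_inj le_ab le_ab' Em.
  apply/idP/mapP => [xm|[[b a]]].
    have [a [b [le_ab Ex]]] := mdeg2P (deg_m _ xm).
    by exists (b, a); rewrite // mem_enum !inE /= le_ab -Ex.
  by rewrite mem_enum !inE /= => /andP[_ abm] ->.
rewrite -(big_tuple _ _ m xpredT (fun x => f (max_index x - 1)%N)).
rewrite (perm_big _ perm_mG) big_map big_enum /=.
rewrite (eq_bigl (fun x => xpredT x.1 && (x.2 \in lex_column x.1))); last by move=> x; rewrite !inE.
rewrite -(pair_big_dep xpredT (fun b a => a \in lex_column b)
  (fun b a => f (max_index (mon (b, a)) - 1)%N)) /=.
apply: eq_bigr => b _; rewrite -sum_nat_const; apply: eq_bigr => a.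
by rewrite inE => /andP[le_ab _]; rewrite max_index_mul // subn1.
Qed.

Lemma card_lex_column b : (#|lex_column b| <= b.+1)%N.
Proof.
rewrite -(card_ord_lt (ltn_ord b)) subset_leq_card //.
by apply/subsetP => a; rewrite !inE => /andP[].
Qed.

(** All elements a of column b but the largest one a1 stay in column c: X_a X_c
    is lexicographically larger than X_a1 X_b, which belongs to m. *)
Lemma lex_columnS (b c : 'I_n) : (b <= c)%N -> (#|lex_column b| <= #|lex_column c|.+1)%N.
Proof.
move=> le_bc; have [_ _ up_m] := lexm.
have [->|ne0] := eqVneq (lex_column b) set0; first by rewrite cards0.
have [a1 a1b max_a1] := ex_max_in (@nat_of_ord n) ne0.
rewrite (cardsD1 a1) a1b ltnS subset_leq_card //.
apply/subsetP=> a; rewrite in_setD1 => /andP[ne_a1 ab].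
have lt_a : (a < a1)%N by rewrite ltn_neqAle max_a1 // andbT val_eqE.
move: ab a1b; rewrite !inE => /andP[le_ab _] /andP[le_a1b a1bm].
rewrite (leq_trans le_ab le_bc) /=; apply: contraT => acm.
have [|s [eq_s lt_s]] := up_m _ _ a1bm _ acm; first by rewrite mdegD !mdeg1.
have le_a1s : (a1 <= s)%N.
  move: (leq_ltn_trans (leq0n _) lt_s); rewrite mnmDE !mnm1E.
  by case: eqP => [<-//|_]; case: eqP => [<-|].
have := eq_s a (leq_trans lt_a le_a1s); rewrite !mnmDE !mnm1E eqxx.
rewrite -!val_eqE /= (gtn_eqF lt_a) gtn_eqF //.
exact: leq_trans lt_a le_a1b.
Qed.

End Lex.

(** * The bound on the linear strand *)

Theorem proposition3p3 (k : fieldType) (n : nat) (E : {set {set 'I_n}})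
    (simpleE : simple_graph E) (m : #|E|.-tuple 'X_{1..n})
    (lexm : lex_largest 2 m)
    (F : graded_free_resolution (@edge_ideal k n E)) (i : nat) :
  (graded_betti F i (i + 2) <=
     \sum_(t < #|E|) 'C(max_index (tnth m t) - 1, i))%N.
Proof.
have [pos deg_pos] := degree_order E.
apply: leq_trans (betti_le_arcs pos simpleE F i) _.
pose f c := 'C(c, i).
rewrite (sum_linear_colon E pos f) (sum_lex_column lexm f).
pose h (b : 'I_n) := diag_count (profile E pos) b.
apply: (@single_crossing _ _ h) => [b c|| b c hb le_bc]; first exact: leq_bin2l.
- have sum_h : (\sum_b h b)%N = #|E|.
    rewrite -(card_arcs pos simpleE) -sum1_card (sum_linear_colon E pos (fun=> 1%N)).
    by apply: eq_bigr => b _; rewrite muln1.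
  rewrite sum_h; transitivity (\sum_(t < #|E|) 1)%N; last by rewrite sum1_card card_ord.
  by rewrite (sum_lex_column lexm (fun=> 1%N)); apply: eq_bigr => b _; rewrite muln1.
(* h c <= h b < g b <= g c + 1; the first step holds since g b <= b + 1 makes h b
   smaller than its maximal value b + 1 *)
have le_hb : (h b <= b)%N by rewrite -ltnS (leq_trans hb) ?card_lex_column.
apply: leq_trans (diag_count_anti (profile_anti deg_pos) le_hb le_bc) _.
by rewrite -ltnS (leq_trans hb) // lex_columnS.
Qed.
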